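(* Let $S_0(x,y)=y^2+(x^2+1)y+x^3$, let $y_-(e^{i\theta})$ be the root of smaller modulus of $S_0(e^{i\theta},y)=0$ for $\theta\in[0,\pi]$, and put $$I_1=\frac1\pi\int_0^{\pi/2}\log|y_-(e^{i\theta})|\,d\theta,\qquad I_2=\frac1\pi\int_{\pi/2}^{\pi}\log|y_-(e^{i\theta})|\,d\theta.$$ Then the identity $I_1-I_2=b_{11}$ is equivalent to the pair of identities $$I_1=\frac{b_{11}-m(S_0)}{2},\qquad I_2=-\frac{b_{11}+m(S_0)}{2}.$$
   Context: $m(P)=\int_0^1\int_0^1\log|P(e^{2\pi i t_1},e^{2\pi i t_2})|\,dt_1\,dt_2$ is the logarithmic Mahler measure. $b_{11}=L'(E_{11},0)$, where $E_{11}$ is any elliptic curve over $\mathbb{Q}$ of conductor $11$. *)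

(* Defs.v *)
From HB Require Import structures.
From mathcomp Require Import all_boot all_order all_algebra.
From mathcomp Require Import all_classical all_reals all_analysis.
From mathcomp Require Import complex.

Set Implicit Arguments.
Unset Strict Implicit.
Unset Printing Implicit Defensive.

Import Order.TTheory GRing.Theory Num.Theory.
Import numFieldNormedType.Exports.
Import ComplexField.

Local Open Scope classical_set_scope.
Local Open Scope ring_scope.
Local Open Scope complex_scope.

(* y^2 + a1 x y + a3 y = x^3 + a2 x^2 + a4 x + a6 *)
Record weierstrass (K : Type) := Weierstrass {
  wa1 : K; wa2 : K; wa3 : K; wa4 : K; wa6 : K }.

Definition map_weierstrass (K L : Type) (f : K -> L) (W : weierstrass K) :
    weierstrass L :=
  Weierstrass (f (wa1 W)) (f (wa2 W)) (f (wa3 W)) (f (wa4 W)) (f (wa6 W)).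

Definition wb2 (K : comNzRingType) (W : weierstrass K) : K :=
  wa1 W ^+ 2 + 4 * wa2 W.
Definition wb4 (K : comNzRingType) (W : weierstrass K) : K :=
  2 * wa4 W + wa1 W * wa3 W.
Definition wb6 (K : comNzRingType) (W : weierstrass K) : K :=
  wa3 W ^+ 2 + 4 * wa6 W.
Definition wb8 (K : comNzRingType) (W : weierstrass K) : K :=
  wa1 W ^+ 2 * wa6 W + 4 * wa2 W * wa6 W - wa1 W * wa3 W * wa4 W
  + wa2 W * wa3 W ^+ 2 - wa4 W ^+ 2.
Definition wc4 (K : comNzRingType) (W : weierstrass K) : K :=
  wb2 W ^+ 2 - 24 * wb4 W.
Definition wdisc (K : comNzRingType) (W : weierstrass K) : K :=
  - (wb2 W ^+ 2 * wb8 W) - 8 * wb4 W ^+ 3 - 27 * wb6 W ^+ 2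
  + 9 * wb2 W * wb4 W * wb6 W.

(* An elliptic curve over a field is given by a Weierstrass equation with
   nonzero discriminant, up to the isomorphisms below. *)
Definition is_elliptic (K : comNzRingType) (W : weierstrass K) : bool :=
  wdisc W != 0.

Definition weierstrass_on (K : comNzRingType) (W : weierstrass K) (x y : K) :=
  y ^+ 2 + wa1 W * x * y + wa3 W * y ==
  x ^+ 3 + wa2 W * x ^+ 2 + wa4 W * x + wa6 W.

(* W' is obtained from W by the admissible substitution
   x = u^2 x' + r, y = u^3 y' + u^2 s x' + t. *)
Definition weierstrass_iso (K : fieldType) (W W' : weierstrass K) : Prop :=
  exists u r s t : K,
    u != 0 /\
    u * wa1 W' = wa1 W + 2 * s /\
    u ^+ 2 * wa2 W' = wa2 W - s * wa1 W + 3 * r - s ^+ 2 /\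
    u ^+ 3 * wa3 W' = wa3 W + r * wa1 W + 2 * t /\
    u ^+ 4 * wa4 W' = wa4 W - s * wa3 W + 2 * r * wa2 W
                      - (t + r * s) * wa1 W + 3 * r ^+ 2 - 2 * s * t /\
    u ^+ 6 * wa6 W' = wa6 W + r * wa4 W + r ^+ 2 * wa2 W + r ^+ 3
                      - t * wa3 W - t ^+ 2 - r * t * wa1 W.

Definition integral_model (E : weierstrass rat) (W : weierstrass int) : Prop :=
  weierstrass_iso E (map_weierstrass (fun a : int => a%:Q) W).

(* The valuation of the discriminant is minimal at every prime; such a model
   exists for every elliptic curve over the rationals. *)
Definition global_minimal_model (E : weierstrass rat) (W : weierstrass int) :
    Prop :=
  integral_model E W /\
  forall W' : weierstrass int, integral_model E W' ->
    forall p : nat, prime p -> (logn p `|wdisc W| <= logn p `|wdisc W'|)%N.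

Definition reduction (p : nat) (W : weierstrass int) : weierstrass 'F_p :=
  map_weierstrass (fun a : int => a%:~R) W.

(* In the next three definitions p is prime and W is minimal at p. *)
Definition good_reduction (W : weierstrass int) (p : nat) : bool :=
  wdisc (reduction p W) != 0.

(* The reduced curve has a node (rather than a cusp) iff c4 <> 0. *)
Definition multiplicative_reduction (W : weierstrass int) (p : nat) : bool :=
  (wdisc (reduction p W) == 0) && (wc4 (reduction p W) != 0).

(* a_p = p + 1 - #W(F_p), where the point at infinity is left out of the count.
   At bad primes this gives 1, -1 or 0 for split multiplicative, nonsplit
   multiplicative or additive reduction (the singular point is counted). *)
Definition trace_frob (W : weierstrass int) (p : nat) : int :=
  p%:Z -
  #|[pred xy : 'F_p * 'F_p | weierstrass_on (reduction p W) xy.1 xy.2]|%:Z.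

(* The conductor of E is the product of the p ^ f_p, where f_p = 0 iff E has
   good reduction at p, f_p = 1 iff it has multiplicative reduction at p, and
   f_p >= 2 otherwise.  So when N is squarefree this says exactly that E has
   conductor N; the wild part of f_p for additive reduction plays no role. *)
Definition has_squarefree_conductor (E : weierstrass rat) (N : nat) : Prop :=
  (0 < N)%N /\
  exists2 W : weierstrass int, global_minimal_model E W &
    forall p : nat, prime p ->
      (good_reduction W p /\ logn p N = 0%N) \/
      (multiplicative_reduction W p /\ logn p N = 1%N).

Definition cexpi (R : realType) (t : R) : R[i] := cos t +i* sin t.

(* x ^ s for real x > 0 and complex s *)
Definition cpow (R : realType) (x : R) (s : R[i]) : R[i] :=
  (x `^ complex.Re s)%:C * cexpi (complex.Im s * ln x).

Definition euler_factor (R : realType) (W : weierstrass int) (s : R[i])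
    (p : nat) : R[i] :=
  (1 - (trace_frob W p)%:~R * cpow p%:R (- s)
     + (if good_reduction W p then cpow p%:R (1 - 2 * s) else 0))^-1.

(* The copy R[i]^o of R[i] carries its topology; differentiability is then
   complex differentiability. *)
Definition entire (R : realType) (L : R[i]^o -> R[i]^o) : Prop :=
  forall s : R[i]^o, derivable L s 1.

(* L(E, .), that is, the (unique) entire continuation of the Euler product. *)
Definition is_Lfunction (R : realType) (E : weierstrass rat)
    (L : R[i]^o -> R[i]^o) : Prop :=
  entire L /\
  exists2 W : weierstrass int, global_minimal_model E W &
    forall s : R[i]^o, 3 / 2 < complex.Re s ->
      (fun n : nat => \prod_(0 <= p < n | prime p) euler_factor W s p : R[i]^o)
        @ \oo --> L s.

Definition is_Lderiv0 (R : realType) (E : weierstrass rat) (b : R) : Prop :=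
  exists2 L : R[i]^o -> R[i]^o, is_Lfunction E L & 'D_1 L 0 = b%:C.

(* Logarithmic Mahler measure of a nonzero two-variable Laurent polynomial.
   Here ln 0 = 0, but P vanishes only on a null set of the torus. *)
Definition mahler (R : realType) (P : R[i] -> R[i] -> R[i]) : R :=
  \int[lebesgue_measure]_(t2 in `[0, 1])
    \int[lebesgue_measure]_(t1 in `[0, 1])
      ln (Normc.normc (P (cexpi (2 * pi * t1)) (cexpi (2 * pi * t2)))).

Definition S0 (R : realType) (x y : R[i]) : R[i] :=
  y ^+ 2 + (x ^+ 2 + 1) * y + x ^+ 3.

(* At the angles 0 and pi / 2 all roots have modulus 1, and any of them is
   allowed. *)
Definition smaller_root (R : realType) (ym : R -> R[i]) : Prop :=
  forall t : R, 0 <= t <= pi ->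
    S0 (cexpi t) (ym t) = 0 /\
    forall w : R[i], S0 (cexpi t) w = 0 -> Normc.normc (ym t) <= Normc.normc w.

Definition I1 (R : realType) (ym : R -> R[i]) : R :=
  pi^-1 * \int[lebesgue_measure]_(t in `[0, pi / 2]) ln (Normc.normc (ym t)).

Definition I2 (R : realType) (ym : R -> R[i]) : R :=
  pi^-1 * \int[lebesgue_measure]_(t in `[pi / 2, pi]) ln (Normc.normc (ym t)).

(* Main.v *)
Require Import Defs.
From HB Require Import structures.
From mathcomp Require Import all_boot all_order all_algebra.
From mathcomp Require Import all_classical all_reals all_analysis.
From mathcomp Require Import measurable_realfun complex.
From mathcomp Require Import ring lra.

Set Implicit Arguments.
Unset Strict Implicit.
Unset Printing Implicit Defensive.

Import Order.TTheory GRing.Theory Num.Theory.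
Import numFieldNormedType.Exports.
Import Normc.

Local Open Scope classical_set_scope.
Local Open Scope ring_scope.

(** The number b11 enters only through elementary algebra: once
      I1 + I2 = - m(S0)
    is known, the equation I1 - I2 = b11 and the pair of identities are the
    same linear system.  So everything rests on this unconditional formula
    ([smaller_root_integrals]).

    Write x = exp(i th) and let y1, y2 be the roots of S0(x, y), with
    |y1| <= |y2|.  Since y1 * y2 = x ^ 3 has modulus 1, |y1| <= 1 <= |y2| and
    log|y1| = - log|y2|.  Jensen's formula on the circle |y| = 1 therefore turns
    the mean of log|S0(x, y)| over y into log|y2|, and averaging over x gives
      m(S0) = 1/pi * int_0^pi log|y2| dth = - (I1 + I2),
    because conjugating x conjugates the roots, so that the two halves of the
    circle |x| = 1 contribute equally.

    Three points need care.

    - Jensen's formula is only needed for roots off the unit circle.  If S0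
      vanishes at a point of the torus, so does its conjugate, and eliminating
      between the two equations leaves (x ^ 2 + 1) * (x - 1) = 0
      ([S0_unit_root]); hence only three points x of the circle are excluded.
      Off the circle the formula follows from
      (1 - a z) * (1 + a z) = 1 - a ^ 2 z ^ 2: the mean M(a) of log|1 - a z|
      satisfies M(a) = M(a ^ 2) / 2 and is bounded on discs smaller than the
      unit disc, so it is zero ([mean_ln_one_sub]).

    - The measure m(S0) integrates over x first, whereas Jensen's formula wants
      y first.  As log|S0| is bounded above by log 4 and its integrals over y
      are nonnegative, it is integrable and Fubini's theorem applies
      ([Rintegral_exchange], [lnS0_abs_bound]).

    - The roots are not chosen continuously, but |y2| is continuous in x: the
      parallelogram law expresses |y1| ^ 2 + |y2| ^ 2 through the sum of the
      roots and the discriminant ([larger_root_sqnormE]).  This makes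
      log|y2| a continuous integrand, for which variables may be changed. *)

(** * Real-valued Lebesgue integrals *)

Section interval_integrals.
Context {R : realType}.
Implicit Types f : R -> R.
Notation mu := (@lebesgue_measure R).

Lemma continuous_itv_integrable f a b : continuous f ->
  mu.-integrable `[a, b] (EFin \o f).
Proof.
move=> cf; apply: continuous_compact_integrable; first exact: segment_compact.
exact: continuous_subspaceT.
Qed.

Lemma Rintegral_itv_split f a b c : continuous f -> a <= b -> b <= c ->
  \int[mu]_(x in `[a, c]) f x =
  \int[mu]_(x in `[a, b]) f x + \int[mu]_(x in `[b, c]) f x.
Proof.
move=> cf ab bc; apply/eqP; rewrite addrC -subr_eq; apply/eqP.
rewrite (Rintegral_itvB (continuous_itv_integrable _ _ cf)) ?bnd_simp//.
rewrite Rintegral_itv_obnd_cbnd//.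
by apply: integrableS (continuous_itv_integrable b c cf) => //;
  apply: subset_itvr; rewrite bnd_simp.
Qed.

Lemma Rintegral_affine f (a b c d : R) : continuous f -> 0 < c -> a <= b ->
  \int[mu]_(x in `[c * a + d, c * b + d]) f x =
  c * \int[mu]_(x in `[a, b]) f (c * x + d).
Proof.
move=> cf c0 ab.
pose F x : R := c * x + d.
have cF : continuous F.
  by move=> x; apply: cvgD; [apply: cvgMl_tmp; exact: cvg_id|exact: cvg_cst].
have dF x : is_derive x (1 : R) F c.
  have -> : F = (c *: (id : R -> R) + cst d)%R by [].
  apply: is_derive_eq.
  by rewrite addr0 /GRing.scale /= mulr1.
have F'E : derive1 F = cst c.
  by apply/funext => x; rewrite derive1E derive_val.
rewrite -RintegralZl//; last first.
  apply: (@continuous_itv_integrable (f \o F)) => x.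
  by apply: continuous_comp; [exact: cF|exact: cf].
rewrite /Rintegral; congr fine.
rewrite -[X in `[X, _]]/(F a) -[X in `[_, X]]/(F b).
rewrite integration_by_substitution_increasing//.
- by apply: eq_integral => x _; rewrite F'E/= mulrC.
- by move=> x y _ _ xy; rewrite ltrD2r ltr_pM2l.
- by rewrite F'E => ? _; exact: cvg_cst.
- by rewrite F'E; exact: is_cvg_cst.
- by rewrite F'E; exact: is_cvg_cst.
- split.
  + by move=> x _.
  + exact/cvg_at_right_filter/cF.
  + exact/cvg_at_left_filter/cF.
- exact: continuous_subspaceT.
Qed.

End interval_integrals.

Section fubini.
Context d1 d2 (T1 : measurableType d1) (T2 : measurableType d2) (R : realType).
Context (m1 : {sigma_finite_measure set T1 -> \bar R}).
Context (m2 : {sigma_finite_measure set T2 -> \bar R}).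

(** Fubini's theorem for iterated real-valued integrals.  Such an integral has
    a default value where the inner one diverges; on the left this can happen,
    but only for a negligible set of y, which the outer integral ignores. *)
Lemma Rintegral_exchange (D1 : set T1) (D2 : set T2) (f : T1 * T2 -> R)
    (M : R) :
    measurable D1 -> measurable D2 -> (m1 D1 < +oo)%E ->
    measurable_fun [set: T1 * T2] f ->
    (forall x, D1 x -> m2.-integrable D2 (fun y => (f (x, y))%:E)) ->
    (forall x, D1 x -> \int[m2]_(y in D2) `|f (x, y)| <= M) ->
  \int[m2]_(y in D2) \int[m1]_(x in D1) f (x, y) =
  \int[m1]_(x in D1) \int[m2]_(y in D2) f (x, y).
Proof.
move=> mD1 mD2 D1fin mf fint fM.
(* Fubini's theorem is applied to the extension by zero of f. *)
pose g : T1 * T2 -> \bar R := (EFin \o f) \_ (D1 `*` D2).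
have mg : measurable_fun [set: T1 * T2] g.
  apply/(measurable_restrictT _ _).1; first exact: measurableX.
  by apply/measurable_EFinP; exact: measurable_funTS.
have gE x y : g (x, y) = if x \in D1 then
    ((fun y => (f (x, y))%:E) \_ D2) y else 0%E.
  rewrite /g /patch in_setX; case: ifPn => /= [/andP[-> ->]//|].
  by case: (x \in D1) (y \in D2) => [] [].
have gE' x y : g (x, y) = if y \in D2 then
    ((fun x => (f (x, y))%:E) \_ D1) x else 0%E.
  rewrite /g /patch in_setX; case: ifPn => /= [/andP[-> ->]//|].
  by case: (x \in D1) (y \in D2) => [] [].
have iabs x : (\int[m2]_y `|g (x, y)|)%E =
    ((fun x => (\int[m2]_(y in D2) `|f (x, y)|)%:E) \_ D1) x.
  rewrite /patch; case: ifPn => [xD1|/negbTE xD1]; last first.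
    by rewrite integral0_eq// => y _; rewrite gE xD1 abse0.
  transitivity (\int[m2]_(y in D2) `|(f (x, y))%:E|)%E.
    rewrite [RHS]integral_mkcond; apply: eq_integral => y _.
    by rewrite gE xD1 restrict_abse.
  rewrite /Rintegral fineK//.
  exact/integrable_fin_num/integrable_norm/fint/set_mem.
have ig : (m1 \x m2)%E.-integrable [set: T1 * T2] g.
  apply/integrable12ltyP => //.
  under eq_integral do rewrite iabs.
  rewrite -integral_mkcond.
  apply: (@le_lt_trans _ _ (\int[m1]_(x in D1) M%:E)%E); last first.
    rewrite [ltLHS](_ : _ = (M * fine (m1 D1))%:E) ?ltry//.
    by rewrite integral_cst// EFinM fineK// ge0_fin_numE.
  apply: ge0_le_integral => //.
  - by move=> x _; rewrite lee_fin Rintegral_ge0.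
  - apply/(measurable_restrictT _ mD1).2.
    rewrite -(funext iabs).
    apply: (measurable_fun_fubini_tonelli_F (abse \o g)) => //=.
    exact: measurableT_comp.
have F1 : (\int[m1]_x \int[m2]_y g (x, y) =
    \int[m1]_(x in D1) (\int[m2]_(y in D2) f (x, y))%:E)%E.
  rewrite [RHS]integral_mkcond; apply: eq_integral => x _.
  rewrite [RHS]/patch; case: ifPn => [xD1|/negbTE xD1]; last first.
    by rewrite integral0_eq// => y _; rewrite gE xD1.
  under eq_integral do rewrite gE xD1.
  rewrite -integral_mkcond /Rintegral fineK//; apply: integrable_fin_num => //.
  exact: (fint x (set_mem xD1)).
have F2 : (\int[m2]_y \int[m1]_x g (x, y) =
    \int[m2]_(y in D2) (\int[m1]_(x in D1) f (x, y))%:E)%E.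
  have mG := measurable_fubini_G ig.
  rewrite [RHS]integral_mkcond.
  transitivity (\int[m2]_y (fine (\int[m1]_x g (x, y)))%:E)%E; last first.
    apply: eq_integral => y _; rewrite [RHS]/patch.
    case: ifPn => [yD2|/negbTE yD2]; last first.
      by rewrite integral0_eq// => x _; rewrite gE' yD2.
    by under eq_integral do rewrite gE' yD2; rewrite -integral_mkcond.
  apply: ae_eq_integral => //.
    by apply/measurable_EFinP; exact: measurableT_comp mG.
  have := ae_integrable2 ig; apply: filterS => y igy _.
  by rewrite fineK//; exact: integrable_fin_num.
by rewrite /Rintegral -F1 -F2 Fubini.
Qed.

End fubini.

Section null_sets.
Context d (T : measurableType d) (R : realType).
Context (m : {measure set T -> \bar R}).

Lemma Rintegral_setD_null (D N : set T) (f : T -> R) :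
    measurable D -> measurable N -> measurable_fun D f -> m N = 0%E ->
  \int[m]_(x in D `\` N) f x = \int[m]_(x in D) f x.
Proof.
move=> mD mN mf N0; rewrite /Rintegral; congr fine.
have mf' : measurable_fun D (EFin \o f) by exact/measurable_EFinP.
(* over D minus N one integrates the function set to zero on N *)
rewrite setDE integral_mkcondr; apply: ae_eq_integral => //.
  apply/(measurable_restrict _ _ mD).1; first exact: measurableC.
  apply: measurable_funS mf' => //.
exists N; split => // x /= /not_implyP[Dx]; apply: contra_notP => Nx.
by rewrite /patch mem_set.
Qed.

End null_sets.

(** * Complex-valued functions and the unit circle *)

Section complex_valued.
Context {R : realType}.
Implicit Types (z w : R[i]) (T : Type).

(** The closure properties shared by continuous and by measurable functions:
    regularity of the complex-valued functions below is derived once, for both,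
    from the regularity of the real and imaginary parts. *)
Record function_algebra T (A : set (T -> R)) : Prop := FunctionAlgebra {
  falgD : forall f g, A f -> A g -> A (fun t => f t + g t);
  falgM : forall f g, A f -> A g -> A (fun t => f t * g t);
  falg_cst : forall c, A (fun=> c);
  falg_comp : forall (phi : R -> R) f, continuous phi -> A f -> A (phi \o f) }.

Definition componentwise T (A : set (T -> R)) (F : T -> R[i]) : Prop :=
  A (fun t => complex.Re (F t)) /\ A (fun t => complex.Im (F t)).

Section closure.
Context T (A : set (T -> R)) (algA : function_algebra A).
Implicit Types F G : T -> R[i].

Lemma componentwise_cst z : componentwise A (fun=> z).
Proof. by split; exact: falg_cst. Qed.

Lemma componentwiseD F G : componentwise A F -> componentwise A G ->
  componentwise A (fun t => F t + G t).
Proof.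
move=> [F1 F2] [G1 G2]; split.
  rewrite (_ : (fun _ => _) = fun t => complex.Re (F t) + complex.Re (G t)).
    exact: falgD.
  by apply/funext => t; case: (F t) (G t) => [? ?] [? ?].
rewrite (_ : (fun _ => _) = fun t => complex.Im (F t) + complex.Im (G t)).
  exact: falgD.
by apply/funext => t; case: (F t) (G t) => [? ?] [? ?].
Qed.

Lemma componentwiseM F G : componentwise A F -> componentwise A G ->
  componentwise A (fun t => F t * G t).
Proof.
move=> [F1 F2] [G1 G2]; split.
  rewrite (_ : (fun _ => _) = fun t => complex.Re (F t) * complex.Re (G t) +
     (-1) * (complex.Im (F t) * complex.Im (G t))).
    apply: falgD; [done|exact: falgM|].
    by apply: falgM; [done|exact: falg_cst|exact: falgM].
  by apply/funext => t; case: (F t) (G t) => [? ?] [? ?] /=; rewrite mulN1r.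
rewrite (_ : (fun _ => _) = fun t => complex.Re (F t) * complex.Im (G t) +
   complex.Im (F t) * complex.Re (G t)).
  by apply: falgD => //; exact: falgM.
by apply/funext => t; case: (F t) (G t) => [? ?] [? ?] /=.
Qed.

Lemma componentwiseB F G : componentwise A F -> componentwise A G ->
  componentwise A (fun t => F t - G t).
Proof.
move=> hF hG; rewrite (_ : (fun _ => _) = fun t => F t + (-1) * G t).
  by apply: componentwiseD => //; apply: componentwiseM => //;
    exact: componentwise_cst.
by apply/funext => t; rewrite mulN1r.
Qed.

Lemma componentwiseX F n : componentwise A F ->
  componentwise A (fun t => F t ^+ n).
Proof.
move=> hF; elim: n => [|n ihn].
  exact: componentwise_cst.
rewrite (_ : (fun _ => _) = fun t => F t * F t ^+ n).
  exact: componentwiseM.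
by apply/funext => t; rewrite exprS.
Qed.

Lemma componentwise_cexpi f : A f -> componentwise A (fun t => cexpi (f t)).
Proof.
by move=> Af; split; apply: (falg_comp algA _ Af);
  [exact: continuous_cos|exact: continuous_sin].
Qed.

Lemma componentwise_normc F : componentwise A F -> A (fun t => normc (F t)).
Proof.
move=> [F1 F2].
rewrite (_ : (fun _ => _) = Num.sqrt \o (fun t => complex.Re (F t) *
    complex.Re (F t) + complex.Im (F t) * complex.Im (F t))).
  apply: (falg_comp algA (@sqrt_continuous R)).
  by apply: falgD => //; exact: falgM.
by apply/funext => t /=; case: (F t) => a b /=; rewrite -!expr2.
Qed.

End closure.

Lemma continuous_algebra (T : topologicalType) :
  function_algebra [set f : T -> R | continuous f].
Proof.
split=> [f g cf cg t|f g cf cg t|c t|phi f cphi cf t].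
- by apply: cvgD; [exact: cf|exact: cg].
- by apply: cvgM; [exact: cf|exact: cg].
- exact: cvg_cst.
- by apply: continuous_comp; [exact: cf|exact: cphi].
Qed.

Lemma measurable_algebra d (T : measurableType d) :
  function_algebra [set f : T -> R | measurable_fun [set: T] f].
Proof.
split=> [f g mf mg|f g mf mg|c|phi f cphi mf] /=.
- exact: measurable_funD.
- exact: measurable_funM.
- exact: measurable_cst.
- by apply: measurableT_comp mf; exact: continuous_measurable_fun.
Qed.

Lemma normc_ge0 z : 0 <= normc z.
Proof. by case: z => a b; exact: sqrtr_ge0. Qed.

Lemma normc_gt0 z : (0 < normc z) = (z != 0).
Proof.
rewrite lt_neqAle normc_ge0 andbT eq_sym.
congr (~~ _); apply/eqP/eqP => [/eq0_normc //|->]; exact: normc0.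
Qed.

Lemma sqr_normcE z : normc z ^+ 2 = complex.Re z ^+ 2 + complex.Im z ^+ 2.
Proof. by case: z => a b /=; rewrite sqr_sqrtr// addr_ge0 ?sqr_ge0. Qed.

Lemma normc_conj z : normc (conjc z) = normc z.
Proof. by case: z => a b /=; rewrite sqrrN. Qed.

Lemma normcX z n : normc (z ^+ n) = normc z ^+ n.
Proof. by elim: n => [|n ihn]; rewrite ?expr0 ?normc1// !exprS normcM ihn. Qed.

Lemma normc_parallelogram z w :
  normc (z + w) ^+ 2 + normc (z - w) ^+ 2 = 2 * (normc z ^+ 2 + normc w ^+ 2).
Proof.
rewrite !sqr_normcE; case: z w => [a b] [c d] /=; ring.
Qed.

Lemma continuous_ln_normc (T : topologicalType) (F : T -> R[i]) :
  componentwise [set f : T -> R | continuous f] F -> (forall t, F t != 0) ->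
  continuous (fun t => ln (normc (F t))).
Proof.
move=> cF F0 t.
apply: (@continuous_comp _ _ _ (fun t => normc (F t) : R) (@ln R)).
  exact: (componentwise_normc (continuous_algebra T) cF).
by apply: continuous_ln; rewrite normc_gt0.
Qed.

Lemma cexpiD (s t : R) : cexpi (s + t) = cexpi s * cexpi t.
Proof. by rewrite /cexpi; simpc; rewrite cosD sinD [sin s * _ + _]addrC. Qed.

Lemma cexpi_pi : cexpi (pi : R) = -1.
Proof.
rewrite /cexpi cospi sinpi; apply/eqP.
by rewrite eq_complex /= oppr0 !eqxx.
Qed.

Lemma normc_cexpi (t : R) : normc (cexpi t) = 1.
Proof. by rewrite /= cos2Dsin2 sqrtr1. Qed.

Lemma unit_circle_conj z : normc z = 1 -> z * conjc z = 1.
Proof.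
move=> z1; have := sqr_normcE z; rewrite z1 expr1n.
case: z z1 => a b _ /= h; apply/eqP; rewrite eq_complex /=.
by apply/andP; split; apply/eqP; [rewrite h; ring|ring].
Qed.

End complex_valued.

(** * Jensen's formula off the unit circle *)

Section jensen.
Context {R : realType}.
Notation mu := (@lebesgue_measure R).
Notation e t := (cexpi (2 * pi * t)).
Implicit Types (a : R[i]) (t : R).

Lemma unit_turnDhalf t : e (t + 2^-1) = - e t.
Proof.
rewrite (_ : 2 * pi * (t + 2^-1) = 2 * pi * t + pi); last by field.
by rewrite cexpiD cexpi_pi mulrN1.
Qed.

Lemma unit_turn_double t : e (2 * t) = e t ^+ 2.
Proof.
by rewrite (_ : 2 * pi * (2 * t) = 2 * pi * t + 2 * pi * t) ?cexpiD//; ring.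
Qed.

Lemma componentwise_unit_turn T (A : set (T -> R)) f : function_algebra A ->
  A f -> componentwise A (fun x => e (f x)).
Proof.
by move=> algA Af; apply: componentwise_cexpi => //;
  apply: falgM => //; exact: falg_cst.
Qed.

Lemma continuous_unit_turn :
  componentwise [set f : R -> R | continuous f] (fun t => e t).
Proof.
apply: (componentwise_unit_turn (continuous_algebra R)) => t; exact: cvg_id.
Qed.

Lemma normcB_bounds a t :
  1 - normc a <= normc (1 - a * e t) <= 1 + normc a.
Proof.
have na : normc (a * e t) = normc a by rewrite normcM normc_cexpi mulr1.
apply/andP; split; last first.
  by rewrite (le_trans (le_normcD _ _))// normcN na normc1.
rewrite lerBlDr -na -[leLHS](@normc1 R).
by rewrite -[X in normc X <= _](subrK (a * e t)) le_normcD.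
Qed.

Lemma one_sub_neq0 a t : normc a < 1 -> 1 - a * e t != 0.
Proof.
move=> a1; rewrite -normc_gt0; have /andP[+ _] := normcB_bounds a t.
by apply: lt_le_trans; rewrite subr_gt0.
Qed.

Lemma continuous_ln_one_sub a : normc a < 1 ->
  continuous (fun t => ln (normc (1 - a * e t))).
Proof.
move=> a1; apply: continuous_ln_normc => [|t]; last exact: one_sub_neq0.
have algC := continuous_algebra (R := R) R.
apply: (componentwiseB algC); first exact: componentwise_cst.
by apply: (componentwiseM algC);
  [exact: componentwise_cst|exact: continuous_unit_turn].
Qed.

Definition circle_mean a : R :=
  \int[mu]_(t in `[0, 1]) ln (normc (1 - a * e t)).

Lemma normc_sqr_lt1 a : normc a < 1 -> normc (a ^+ 2) < 1.
Proof. by move=> a1; rewrite normcX exprn_ilt1 ?normc_ge0. Qed.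

(** The two halves of the circle are exchanged by z -> - z, and
    (1 - a z) * (1 + a z) = 1 - a ^ 2 z ^ 2, where z ^ 2 runs once through the
    circle while z runs through half of it. *)
Lemma circle_mean_sqr a : normc a < 1 ->
  circle_mean a = circle_mean (a ^+ 2) / 2.
Proof.
move=> a1; have a21 := normc_sqr_lt1 a1.
have ca := continuous_ln_one_sub a1.
have ca2 := continuous_ln_one_sub a21.
have -> : circle_mean (a ^+ 2) =
    2 * \int[mu]_(t in `[0, 2^-1]) ln (normc (1 - a ^+ 2 * e (2 * t))).
  have := @Rintegral_affine R _ 0 2^-1 2 0 ca2 ltac:(lra) ltac:(lra).
  rewrite !addr0 mulr0 divff// => h; rewrite /circle_mean h.
  by congr (_ * _); apply: eq_Rintegral => t _; rewrite addr0.
rewrite mulrAC divff// mul1r /circle_mean.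
rewrite (@Rintegral_itv_split R _ 0 2^-1 1 ca ltac:(lra) ltac:(lra)).
have := @Rintegral_affine R _ 0 2^-1 1 2^-1 ca ltac:(lra) ltac:(lra).
rewrite !mul1r add0r (_ : 2^-1 + 2^-1 = 1 :> R); last by lra.
move=> ->.
rewrite -RintegralD//; first 1 last.
- exact: continuous_itv_integrable.
- apply: (@continuous_itv_integrable R
    (fun t => ln (normc (1 - a * e (1 * t + 2^-1))))).
  under eq_fun do rewrite mul1r.
  move=> t; apply: (@continuous_comp _ _ _ (fun t : R => t + 2^-1)
    (fun t => ln (normc (1 - a * e t)))); last exact: ca.
  by apply: cvgD; [exact: cvg_id|exact: cvg_cst].
apply: eq_Rintegral => t _.
rewrite mul1r unit_turnDhalf unit_turn_double.
rewrite -lnM ?posrE ?normc_gt0 -?normcM; last 2 first.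
  exact: one_sub_neq0.
  by rewrite mulrN -mulNr one_sub_neq0// normcN.
by congr (ln (normc _)); ring.
Qed.

(** Squaring does not leave the disc of radius r, so the halving in
    [circle_mean_sqr] may be iterated from a bound that is uniform there. *)
Lemma circle_mean_bound (r : R) n a : r < 1 -> normc a <= r ->
  `|circle_mean a| <= (ln 2 - ln (1 - r)) / 2 ^+ n.
Proof.
move=> r1; elim: n a => [|n ihn] a ar; last first.
  rewrite circle_mean_sqr ?(le_lt_trans ar)// normrM.
  rewrite (@ger0_norm _ 2^-1)// (exprSr 2 n) invfM mulrA ler_pM2r//.
  apply: ihn; rewrite normcX (le_trans _ ar)// expr2.
  by rewrite ler_piMl ?normc_ge0// (le_trans ar)// ltW.
have a1 := le_lt_trans ar r1.
have ca := continuous_ln_one_sub a1.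
have r0 : 0 <= r := le_trans (normc_ge0 _) ar.
rewrite expr0 divr1; apply: (le_trans (le_normr_Rintegral _ _)) => //.
  exact: continuous_itv_integrable.
set B := ln 2 - _.
have -> : B = \int[mu]_(t in `[0, 1]) B.
  by rewrite Rintegral_cst//= lebesgue_measure_itv/= lte01 oppr0 adde0 mulr1.
apply: le_Rintegral => //.
- exact/integrable_norm/continuous_itv_integrable.
- by apply: continuous_itv_integrable => t; exact: cvg_cst.
move=> t _; have /andP[l u] := normcB_bounds a t.
have ln2 : 0 <= ln 2 :> R by apply: ln_ge0; lra.
have ln1r : ln (1 - r) <= 0 by apply: ln_le0; lra.
have lnl : ln (1 - r) <= ln (normc (1 - a * e t)).
  by rewrite ler_ln ?posrE ?subr_gt0 ?normc_gt0 ?one_sub_neq0//; lra.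
have lnu : ln (normc (1 - a * e t)) <= ln 2.
  by rewrite ler_ln ?posrE ?normc_gt0 ?one_sub_neq0//; lra.
by rewrite ler_norml /B; apply/andP; split; lra.
Qed.

Lemma mean_ln_one_sub a : normc a < 1 ->
  \int[mu]_(t in `[0, 1]) ln (normc (1 - a * e t)) = 0.
Proof.
move=> a1; rewrite -/(circle_mean a); apply/eqP; rewrite -normr_eq0.
set B := ln 2 - ln (1 - normc a).
have bnd n : `|circle_mean a| * 2 ^+ n <= B.
  by rewrite -ler_pdivlMr ?exprn_gt0//; exact: circle_mean_bound.
rewrite eq_le normr_ge0 andbT leNgt; apply/negP => c0.
have := bnd (Num.bound (B / `|circle_mean a|)).
rewrite leNgt mulrC -ltr_pdivrMr// => /negP; apply.
apply: lt_le_trans (archi_boundP _) _.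
  by rewrite divr_ge0// (le_trans _ (bnd 0%N))// mulr_ge0.
by rewrite -natrX ler_nat ltnW// ltn_expl.
Qed.

(** On the circle 1 / z is the conjugate of z, so |z - a| = |1 - a^* z|. *)
Lemma jensen_inside a : normc a < 1 ->
  \int[mu]_(t in `[0, 1]) ln (normc (e t - a)) = 0.
Proof.
move=> a1; rewrite -[RHS](@mean_ln_one_sub (conjc a)) ?normc_conj//.
apply: eq_Rintegral => t _; congr ln.
rewrite -[RHS]normc_conj rmorphB rmorph1 rmorphM/= conjcK.
have -> : e t - a = e t * (1 - a * conjc (e t)).
  by rewrite mulrBr mulr1 mulrCA unit_circle_conj ?normc_cexpi// mulr1.
by rewrite normcM normc_cexpi mul1r.
Qed.

(** Here z - a = - a * (1 - a^-1 z), with |a^-1| < 1. *)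
Lemma jensen_outside a : 1 < normc a ->
  \int[mu]_(t in `[0, 1]) ln (normc (e t - a)) = ln (normc a).
Proof.
move=> a1; have a0 : a != 0 by rewrite -normc_gt0 (lt_trans _ a1).
have va1 : normc a^-1 < 1 by rewrite normcV invf_lt1// (lt_trans _ a1).
transitivity (\int[mu]_(t in `[0, 1])
    (ln (normc a) + ln (normc (1 - a^-1 * e t)))).
  apply: eq_Rintegral => t _.
  rewrite -lnM ?posrE ?normc_gt0 ?one_sub_neq0// -normcM.
  by rewrite mulrBr mulr1 mulrA divff// mul1r -normcN opprB.
rewrite RintegralD//; first 1 last.
- by apply: continuous_itv_integrable => t; exact: cvg_cst.
- exact: continuous_itv_integrable (continuous_ln_one_sub va1).
rewrite mean_ln_one_sub// addr0 Rintegral_cst//= lebesgue_measure_itv/= lte01.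
by rewrite oppr0 adde0 mulr1.
Qed.

Lemma continuous_ln_sub a : normc a != 1 ->
  continuous (fun t => ln (normc (e t - a))).
Proof.
move=> a1; apply: continuous_ln_normc => [|t]; last first.
  by apply: contra a1; rewrite subr_eq0 => /eqP <-; rewrite normc_cexpi.
apply: (componentwiseB (continuous_algebra R)).
  exact: continuous_unit_turn.
exact: (componentwise_cst (continuous_algebra R)).
Qed.

Lemma jensen_quadratic a b : normc a < 1 -> 1 < normc b ->
  \int[mu]_(t in `[0, 1]) ln (normc ((e t - a) * (e t - b))) = ln (normc b).
Proof.
move=> a1 b1.
have na1 : normc a != 1 by rewrite lt_eqF.
have nb1 : normc b != 1 by rewrite gt_eqF.
have neq0 c t : normc c != 1 -> e t - c != 0.
  by apply: contra; rewrite subr_eq0 => /eqP <-; rewrite normc_cexpi.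
under eq_Rintegral do
  rewrite normcM lnM ?posrE ?normc_gt0 ?neq0//.
rewrite RintegralD//; first 1 last.
- exact: continuous_itv_integrable (continuous_ln_sub na1).
- exact: continuous_itv_integrable (continuous_ln_sub nb1).
by rewrite jensen_inside// jensen_outside// add0r.
Qed.

End jensen.

(** * The roots of S0 above the unit circle *)

Section S0_roots.
Context {R : realType}.
Implicit Types x y : R[i].

Lemma S0_factor x : exists y1 y2,
  [/\ forall y, S0 x y = (y - y1) * (y - y2),
      y1 * y2 = x ^+ 3 & normc y1 <= normc y2].
Proof.
pose s := x ^+ 2 + 1; pose d := sqrtC (s ^+ 2 - 4 * x ^+ 3).
pose r1 := (- s - d) / 2; pose r2 := (- s + d) / 2.
have d2 : d ^+ 2 = s ^+ 2 - 4 * x ^+ 3 by rewrite sqrtCK.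
have r12 : r1 * r2 = x ^+ 3.
  rewrite (_ : r1 * r2 = (s ^+ 2 - d ^+ 2) / 4); last by rewrite /r1 /r2; field.
  by rewrite d2; field.
have r1r2 : r1 + r2 = - s by rewrite /r1 /r2; field.
have fact y : S0 x y = (y - r1) * (y - r2).
  rewrite (_ : _ * _ = y ^+ 2 - (r1 + r2) * y + r1 * r2); last by ring.
  by rewrite r12 r1r2 mulNr opprK.
have [le12|/ltW le21] := leP (normc r1) (normc r2); first by exists r1, r2.
by exists r2, r1; split=> [y||//]; [rewrite fact mulrC|rewrite mulrC].
Qed.

Section unit_circle.
Context (x y1 y2 : R[i]) (x1 : normc x = 1)
  (fact : forall y, S0 x y = (y - y1) * (y - y2))
  (prod_roots : y1 * y2 = x ^+ 3) (le12 : normc y1 <= normc y2).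

Lemma normc_S0_roots : normc y1 * normc y2 = 1.
Proof. by rewrite -normcM prod_roots normcX x1 expr1n. Qed.

Lemma larger_root_ge1 : 1 <= normc y2.
Proof.
rewrite leNgt; apply/negP => y21; have := normc_S0_roots.
move/eqP; rewrite lt_eqF// (le_lt_trans _ y21)// ler_piMl ?normc_ge0//.
by rewrite (le_trans le12)// ltW.
Qed.

(** A zero of S0 on the torus is also a zero of the conjugate polynomial, that
    is of x ^ 3 + (x + x ^ 3) y + y ^ 2 after clearing denominators; the
    difference of the two equations is y * (x ^ 2 + 1) * (x - 1) = 0. *)
Lemma S0_unit_root y : normc y = 1 -> S0 x y = 0 -> (x ^+ 2 + 1) * (x - 1) = 0.
Proof.
move=> ny Sy.
have xx := unit_circle_conj x1; have yy := unit_circle_conj ny.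
have Sy' : S0 (conjc x) (conjc y) = 0.
  rewrite -[0](rmorph0 (@conjc R)) -Sy /S0.
  by rewrite !(rmorphD, rmorphM, rmorphXn, rmorph1).
have y0 : y != 0 by rewrite -normc_gt0 ny.
have recip : x ^+ 3 + (x + x ^+ 3) * y + y ^+ 2 = 0.
  rewrite -[RHS](mulr0 (x ^+ 3 * y ^+ 2)) -Sy' /S0.
  rewrite [RHS](_ : _ = x ^+ 3 * (y * conjc y) ^+ 2 +
    (x * (x * conjc x) ^+ 2 + x ^+ 3) * y * (y * conjc y) +
    (x * conjc x) ^+ 3 * y ^+ 2); last by ring.
  by rewrite xx yy; ring.
apply: (mulfI y0); rewrite mulr0 -[RHS](subrr 0) -{1}recip -Sy /S0; ring.
Qed.

Lemma larger_root_gt1 : (x ^+ 2 + 1) * (x - 1) != 0 ->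
  normc y1 < 1 /\ 1 < normc y2.
Proof.
move=> good.
have y21 : normc y2 != 1.
  apply: contra good => /eqP y21; apply/eqP/(S0_unit_root y21).
  by rewrite fact subrr mulr0.
have gt1 : 1 < normc y2 by rewrite lt_neqAle eq_sym y21 larger_root_ge1.
split=> //; rewrite -normc_S0_roots ltr_pMr//.
rewrite normc_gt0; apply/eqP => y10; have := normc_S0_roots.
by rewrite y10 normc0 mul0r => /esym/eqP; rewrite oner_eq0.
Qed.

End unit_circle.
End S0_roots.

(** * The modulus of the larger root *)

Section larger_root.
Context {R : realType}.
Notation mu := (@lebesgue_measure R).
Notation e t := (cexpi (2 * pi * t)).
Implicit Types (x y : R[i]) (t : R).

(** With p = |y1| ^ 2 + |y2| ^ 2 and |y1| * |y2| = 1, the number |y2| ^ 2 is the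
    larger solution of u + 1 / u = p.  By the parallelogram law p is half of
    |y1 + y2| ^ 2 + |y1 - y2| ^ 2, and (y1 - y2) ^ 2 is the discriminant of S0
    in y.  This form does not refer to a choice of roots. *)
Definition larger_root_sqnorm x : R :=
  let p := (normc (x ^+ 2 + 1) ^+ 2
            + normc ((x ^+ 2 + 1) ^+ 2 - 4 * x ^+ 3)) / 2 in
  (p + Num.sqrt (p ^+ 2 - 4)) / 2.

Definition log_larger_root (th : R) : R :=
  ln (larger_root_sqnorm (cexpi th)) / 2.

Lemma larger_root_sqnormE x y1 y2 : normc x = 1 ->
    (forall y, S0 x y = (y - y1) * (y - y2)) ->
    y1 * y2 = x ^+ 3 -> normc y1 <= normc y2 ->
  larger_root_sqnorm x = normc y2 ^+ 2.
Proof.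
move=> x1 fact prod le12; rewrite /larger_root_sqnorm.
have sum_roots : y1 + y2 = - (x ^+ 2 + 1).
  have h1 := fact 1; have h0 := fact 0.
  have -> : y1 + y2 = 1 + (0 - y1) * (0 - y2) - (1 - y1) * (1 - y2) by ring.
  by rewrite -h1 -h0 /S0; ring.
have diff_roots : (x ^+ 2 + 1) ^+ 2 - 4 * x ^+ 3 = (y1 - y2) ^+ 2.
  by rewrite -prod -[X in X ^+ 2 - _]opprK -sum_roots; ring.
rewrite diff_roots normcX -(normcN (x ^+ 2 + 1)) -sum_roots.
rewrite normc_parallelogram mulrAC divff// mul1r.
have nn := normc_S0_roots x1 prod.
have -> : (normc y1 ^+ 2 + normc y2 ^+ 2) ^+ 2 - 4 =
    (normc y2 ^+ 2 - normc y1 ^+ 2) ^+ 2.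
  rewrite (_ : 4 = 4 * (normc y1 * normc y2) ^+ 2); first by ring.
  by rewrite nn expr1n mulr1.
rewrite sqrtr_sqr ger0_norm ?subr_ge0 ?ler_sqr ?nnegrE ?normc_ge0//.
by field.
Qed.

Lemma log_larger_rootE (th : R) y1 y2 :
    (forall y, S0 (cexpi th) y = (y - y1) * (y - y2)) ->
    y1 * y2 = cexpi th ^+ 3 -> normc y1 <= normc y2 ->
  log_larger_root th = ln (normc y2).
Proof.
move=> fact prod le12; have x1 := normc_cexpi th.
rewrite /log_larger_root (larger_root_sqnormE x1 fact prod le12).
rewrite lnXn ?(lt_le_trans ltr01 (larger_root_ge1 x1 prod le12))//.
by rewrite mulr2n; field.
Qed.

(** Where |y1| = |y2| neither root is distinguished as the larger one, but the
    closed formula for the modulus is continuous there too; it is at least 1,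
    where the logarithm is continuous. *)
Lemma continuous_log_larger_root : continuous log_larger_root.
Proof.
move=> th; apply: cvgMr_tmp.
have algC := continuous_algebra (R := R) R.
have cx : componentwise [set f : R -> R | continuous f] (fun t => cexpi t).
  by apply: (componentwise_cexpi algC) => t; exact: cvg_id.
have ck z := componentwise_cst algC z.
have cs := componentwiseD algC (componentwiseX algC 2 cx) (ck 1).
have cn1 := componentwise_normc algC cs.
have cn2 := componentwise_normc algC (componentwiseB algC
  (componentwiseX algC 2 cs) (componentwiseM algC (ck 4)
     (componentwiseX algC 3 cx))).
have cp := falgM algC (falgD algC (falgM algC cn1 cn1) cn2)
   (falg_cst algC 2^-1).
have cd := falgD algC (falgM algC cp cp) (falg_cst algC (- 4)).
have cr := falgM algC (falgD algC cp (falg_comp algC (@sqrt_continuous R) cd))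
   (falg_cst algC 2^-1).
apply: (@continuous_comp _ _ _
  (fun th => larger_root_sqnorm (cexpi th)) (@ln R)).
  exact: cr.
apply: continuous_ln.
have [y1 [y2 [fact prod le12]]] := S0_factor (cexpi th).
rewrite (larger_root_sqnormE (normc_cexpi th) fact prod le12) exprn_gt0//.
exact: lt_le_trans ltr01 (larger_root_ge1 (normc_cexpi th) prod le12).
Qed.

(** The angle of 1 - t turns is that of the conjugate point, and S0 has real
    coefficients. *)
Lemma log_larger_root_sym t :
  log_larger_root (2 * pi * (1 - t)) = log_larger_root (2 * pi * t).
Proof.
rewrite /log_larger_root.
have -> : cexpi (2 * pi * (1 - t)) = conjc (e t) :> R[i].
  rewrite (_ : 2 * pi * (1 - t) = - (2 * pi * t) + pi + pi); last by ring.
  rewrite 2!cexpiD cexpi_pi -mulrA mulrNN !mulr1.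
  by rewrite /cexpi cosN sinN.
rewrite /larger_root_sqnorm -(normc_conj (e t ^+ 2 + 1)).
rewrite -(normc_conj ((e t ^+ 2 + 1) ^+ 2 - _)).
by rewrite !(rmorphB, rmorphD, rmorphM, rmorphXn, rmorph1, rmorph_nat).
Qed.

Lemma log_smaller_root (ym : R -> R[i]) (th : R) : smaller_root ym ->
  0 <= th <= pi -> ln (normc (ym th)) = - log_larger_root th.
Proof.
move=> /[apply] -[root minim].
have [y1 [y2 [fact prod le12]]] := S0_factor (cexpi th).
have x1 := normc_cexpi th.
have nn := normc_S0_roots x1 prod.
have gt0 := lt_le_trans ltr01 (larger_root_ge1 x1 prod le12).
rewrite (log_larger_rootE fact prod le12) -lnV//; congr ln.
have -> : normc (ym th) = normc y1.
  have le1 : normc (ym th) <= normc y1.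
    by apply: minim; rewrite fact subrr mul0r.
  move/eqP: root; rewrite fact mulf_eq0 !subr_eq0 => /orP[/eqP ->//|/eqP ymE].
  by apply/eqP; rewrite eq_le le1 ymE.
by rewrite -[RHS]mul1r -nn mulfK// gt_eqF.
Qed.

(** The turns t in [0, 1] at which x = e t is one of 1, 'i, -'i, that is, at
    which (x ^ 2 + 1) * (x - 1) = 0. *)
Definition bad_turns : set R := [set 0; 4^-1; 3 / 4; 1].

Lemma bad_turns_null : mu bad_turns = 0%E.
Proof.
apply: countable_lebesgue_measure0; apply: finite_set_countable.
by rewrite /bad_turns !finite_setU.
Qed.

Lemma good_turn t : (`[0, 1] `\` bad_turns) t ->
  (e t ^+ 2 + 1) * (e t - 1) != 0.
Proof.
move=> [/=]; rewrite in_itv/= => /andP[t0 t1] tgood.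
have cosC : cos (2 * pi * (1 - t)) = cos (2 * pi * t).
  rewrite (_ : 2 * pi * (1 - t) = - (2 * pi * t) + pi + pi); last by ring.
  by rewrite !cosDpi opprK cosN.
have p0 := pi_gt0 R.
(* t or 1 - t has its angle in [0, pi], where the cosine is injective *)
have [s [s0 s1 cs st]] : exists s, [/\ 0 <= s, s <= 2^-1,
    cos (2 * pi * s) = cos (2 * pi * t) & s = t \/ s = 1 - t].
  have [th|th] := leP t 2^-1; first by exists t; split=> //; left.
  by exists (1 - t); split; rewrite ?cosC//; [lra|lra|right].
have sI : 2 * pi * s \in `[0, pi].
  by rewrite in_itv/=; apply/andP; split; nra.
apply: contra_not_neq tgood => /eqP; rewrite mulf_eq0 => /orP[|].
  rewrite addr_eq0 => /eqP/(congr1 (@complex.Re R))/= cos2.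
  have c0 : cos (2 * pi * t) = 0.
    apply/eqP; rewrite -sqrf_eq0; apply/eqP.
    by have := cos2Dsin2 (2 * pi * t); rewrite !expr2; lra.
  have pih : (pi / 2 : R) \in `[0, pi].
    by rewrite in_itv/=; apply/andP; split; lra.
  have /(cos_inj sI pih) sE : cos (2 * pi * s) = cos (pi / 2).
    by rewrite cs c0 cos_pihalf.
  have {}sE : s = 4^-1.
    by apply: (mulfI (lt0r_neq0 p0)); lra.
  by rewrite /bad_turns/=; case: st => ?; [left; left; right|left; right]; lra.
rewrite subr_eq0 eq_complex/= => /andP[/eqP c1 _].
have pi0 : (0 : R) \in `[0, pi] by rewrite in_itv/=; apply/andP; split; lra.
have /(cos_inj sI pi0) sE : cos (2 * pi * s) = cos 0 by rewrite cs c1 cos0.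
have {}sE : s = 0 by apply: (mulfI (lt0r_neq0 p0)); lra.
by rewrite /bad_turns/=; case: st => ?; [left; left; left|right]; lra.
Qed.

End larger_root.

Arguments bad_turns {R}.

(** * The Mahler measure of S0 *)

Section mahler_S0.
Context {R : realType}.
Notation mu := (@lebesgue_measure R).
Notation e t := (cexpi (2 * pi * t)).
Implicit Types t : R.

Definition lnS0 (p : R * R) : R :=
  ln (normc (S0 (e p.1) (e p.2))).

Lemma measurable_lnS0 :
  measurable_fun [set: measurableTypeR R * measurableTypeR R] lnS0.
Proof.
have algM :=
  @measurable_algebra R _ (measurableTypeR R * measurableTypeR R)%type.
have me1 := componentwise_unit_turn (f := fst) algM (@measurable_fst _ _ _ _).
have me2 := componentwise_unit_turn (f := snd) algM (@measurable_snd _ _ _ _).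
have ck z := componentwise_cst algM z.
have mx := componentwiseD algM (componentwiseX algM 2 me1) (ck 1).
have mS := componentwiseD algM (componentwiseD algM (componentwiseX algM 2 me2)
  (componentwiseM algM mx me2)) (componentwiseX algM 3 me1).
exact: measurableT_comp (componentwise_normc algM mS).
Qed.

Lemma normc_S0_le4 (s t : R) : normc (S0 (e s) (e t)) <= 4.
Proof.
rewrite /S0; have n1 := normc_cexpi.
apply: le_trans (le_normcD _ _) _; rewrite [normc (_ ^+ 3)]normcX n1 expr1n.
apply: le_trans (lerD (le_normcD _ _) (lexx _)) _.
have le2 : normc (e s ^+ 2 + 1) <= 2.
  by apply: le_trans (le_normcD _ _) _; rewrite normcX n1 expr1n normc1; lra.
rewrite [normc (e t ^+ 2)]normcX normcM !n1 expr1n mulr1; lra.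
Qed.

Lemma lnS0_good_turn t : (`[0, 1] `\` bad_turns) t ->
  mu.-integrable `[0, 1] (fun u => (lnS0 (t, u))%:E) /\
  \int[mu]_(u in `[0, 1]) lnS0 (t, u) = log_larger_root (2 * pi * t).
Proof.
move=> /good_turn good.
have [y1 [y2 [fact prod le12]]] := S0_factor (e t).
have [y11 y21] := larger_root_gt1 (normc_cexpi _) fact prod le12 good.
rewrite (log_larger_rootE fact prod le12) -(jensen_quadratic y11 y21).
have lnS0E u : lnS0 (t, u) = ln (normc ((e u - y1) * (e u - y2))).
  by rewrite -fact.
split; last by apply: eq_Rintegral.
apply: (@continuous_itv_integrable R (fun u => lnS0 (t, u))).
rewrite (funext lnS0E); apply: continuous_ln_normc => [|u].
  have algC := continuous_algebra (R := R) R.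
  by apply: (componentwiseM algC); apply: (componentwiseB algC);
    by [exact: continuous_unit_turn|exact: componentwise_cst].
by rewrite mulf_neq0// subr_eq0; apply/eqP => /(congr1 (@normc R));
  rewrite normc_cexpi => h; move: y11 y21; rewrite -h ltxx.
Qed.

(** As log|S0| <= log 4, its absolute value is at most 2 * log 4 - log|S0|, and
    the integral of log|S0| over y is log|y2| >= 0. *)
Lemma lnS0_abs_bound t : (`[0, 1] `\` bad_turns) t ->
  \int[mu]_(u in `[0, 1]) `|lnS0 (t, u)| <= 2 * ln 4.
Proof.
move=> tgood; have [ilnS0 lnS0E] := lnS0_good_turn tgood.
have [y1 [y2 [fact prod le12]]] := S0_factor (e t).
have big := larger_root_ge1 (normc_cexpi _) prod le12.
have log_ge0 := ln_ge0 big.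
have ic (c : R) : mu.-integrable `[0, 1] (EFin \o fun=> c).
  by apply: continuous_itv_integrable => ?; exact: cvg_cst.
have ln4 : 0 <= ln 4 :> R by apply: ln_ge0; lra.
apply: (@le_trans _ _ (\int[mu]_(u in `[0, 1]) (2 * ln 4 - lnS0 (t, u)))).
  apply: le_Rintegral => //.
  - exact: integrable_norm.
  - exact: (integrableB _ (ic (2 * ln 4)) ilnS0).
  move=> u _; have : lnS0 (t, u) <= ln 4.
    rewrite -[lnS0 _]/(ln (normc (S0 (e t) (e u)))).
    have := normc_S0_le4 t u; have := normc_ge0 (S0 (e t) (e u)).
    rewrite le_eqVlt => /orP[/eqP <- _|gt0 le4]; first by rewrite ln0 ?lexx.
    by rewrite ler_ln ?posrE//; lra.
  by rewrite ler_norml => h; apply/andP; split; lra.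
rewrite RintegralB// lnS0E (log_larger_rootE fact prod le12).
rewrite Rintegral_cst//= lebesgue_measure_itv/= lte01 oppr0 adde0 mulr1; lra.
Qed.

(** Discarding the bad turns of x costs nothing and makes every inner integral
    over y an instance of Jensen's formula. *)
Lemma mahler_S0 : mahler (@S0 R) =
  pi^-1 * \int[mu]_(th in `[0, pi]) log_larger_root th.
Proof.
have mbad : measurable (bad_turns : set (measurableTypeR R)).
  by rewrite /bad_turns; do 3 apply: measurableU => //.
have mlnS0 := measurable_lnS0.
pose lam := @lebesgue_measure R.
have -> : mahler (@S0 R) = \int[lam]_(u in `[0, 1])
    \int[lam]_(t in `[0, 1] `\` bad_turns) lnS0 (t, u).
  apply: eq_Rintegral => u _; rewrite Rintegral_setD_null//.
    apply: measurable_funTS.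
    exact: (measurable_fun_pair1 u mlnS0).
  exact: bad_turns_null.
rewrite (@Rintegral_exchange _ _ _ _ R lam lam _ _ lnS0 (2 * ln 4))//;
  first last.
- exact: lnS0_abs_bound.
- by move=> t /lnS0_good_turn[].
- rewrite (@le_lt_trans _ _ (lam `[0, 1]%classic))//; last first.
    by rewrite /lam lebesgue_measure_itv/= lte01 oppr0 adde0 ltry.
  by apply: le_measure; rewrite ?inE//; exact: measurableD.
- exact: measurableD.
have cL := @continuous_log_larger_root R.
have cLt : continuous (fun t : R => log_larger_root (2 * pi * t)).
  move=> t.
  apply: (@continuous_comp _ _ _ (fun t : R => 2 * pi * t)); last exact: cL.
  by apply: cvgMl_tmp; exact: cvg_id.
transitivity (\int[mu]_(t in `[0, 1] `\` bad_turns)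
    log_larger_root (2 * pi * t)).
  by apply: eq_Rintegral => t /set_mem/lnS0_good_turn[].
rewrite Rintegral_setD_null//; first last.
- exact: bad_turns_null.
- by apply: measurable_funTS; exact: continuous_measurable_fun.
rewrite (@Rintegral_itv_split R _ 0 2^-1 1 cLt ltac:(lra) ltac:(lra)).
have p0 := pi_gt0 R.
have -> : \int[mu]_(t in `[2^-1, 1]) log_larger_root (2 * pi * t) =
    \int[mu]_(t in `[0, 2^-1]) log_larger_root (2 * pi * t).
  rewrite [RHS]Rintegration_by_substitution_onem; last 2 first.
  - by apply/andP; split; lra.
  - exact: continuous_subspaceT.
  rewrite /unstable.onem (_ : 1 - 2^-1 = 2^-1); last by lra.
  by apply: eq_Rintegral => t _; exact/esym/log_larger_root_sym.
have := @Rintegral_affine R _ 0 2^-1 (2 * pi) 0 cL ltac:(lra) ltac:(lra).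
rewrite mulr0 !addr0 (_ : 2 * pi * 2^-1 = pi); last by field.
under [in X in _ = X -> _]eq_Rintegral do rewrite addr0.
move=> ->; rewrite (mulrC 2) -mulrA mulKf ?gt_eqF//.
by rewrite mulr_natl mulr2n.
Qed.

Lemma smaller_root_integrals (ym : R -> R[i]) : smaller_root ym ->
  I1 ym + I2 ym = - mahler (@S0 R).
Proof.
move=> ymP; have p0 := pi_gt0 R.
have cL := @continuous_log_larger_root R.
rewrite mahler_S0 /I1 /I2 -mulrDr -mulrN; congr (_ * _).
rewrite (@Rintegral_itv_split R _ 0 (pi / 2) pi cL ltac:(lra) ltac:(lra)).
rewrite opprD.
have half (a b : R) : 0 <= a -> b <= pi ->
    \int[mu]_(t in `[a, b]) ln (normc (ym t)) =
    - \int[mu]_(t in `[a, b]) log_larger_root t.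
  move=> a0 bpi; rewrite -mulN1r -RintegralZl//; last first.
    exact: continuous_itv_integrable.
  apply: eq_Rintegral => t; rewrite inE/= in_itv/= => /andP[at_ tb].
  by rewrite mulN1r log_smaller_root// (le_trans a0)//= (le_trans tb).
by rewrite !half//; lra.
Qed.

End mahler_S0.

Theorem corollary3p2 (R : realType)
    (E11 : weierstrass rat) (ellE : is_elliptic E11)
    (condE : has_squarefree_conductor E11 11)
    (b11 : R) (b11E : is_Lderiv0 E11 b11)
    (ym : R -> complex R) (ymP : smaller_root ym) :
  I1 ym - I2 ym = b11 <->
  (I1 ym = (b11 - mahler (@S0 R)) / 2 /\
   I2 ym = - ((b11 + mahler (@S0 R)) / 2)).
Proof.
have := smaller_root_integrals ymP.
by split=> [|[]]; [split|]; lra.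
Qed.
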